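(* Let $L$ be a finite lattice with minimum $\hat 0$ and maximum $\hat 1$, and let $\hat 0=x_0<x_1<\dots<x_k=\hat 1$ be a chain in $L$ containing $\hat 0$ and $\hat 1$ (not necessarily maximal). Let $\gamma_1,\gamma_2,\gamma_3,\gamma_4$ be the four edge-labellings of $L$ associated with this chain (defined in the context). Then for every cover relation $b\lessdot c$ of $L$, $$\gamma_2(b\lessdot c)=\gamma_3(b\lessdot c)\le\gamma_1(b\lessdot c)=\gamma_4(b\lessdot c).$$ Moreover, $\gamma_2=\gamma_4$ (as functions on the set of cover relations of $L$) if and only if $x_i$ is left modular for every $i\in\{0,\dots,k\}$.
   Context: All lattices are finite. $b\lessdot c$ means that $c$ covers $b$. $\mathrm{JIrr}(L)$ is the set of join-irreducible elements (elements covering exactly one element) and $\mathrm{MIrr}(L)$ the set of meet-irreducible elements (elements covered by exactly one element). An element $a\in L$ is left modular if for all $b<c$ in $L$, $(b\vee a)\wedge c=b\vee(a\wedge c)$. For $j\in\mathrm{JIrr}(L)$ put $\delta(j):=\min\{i\mid j\le x_i\}$; for $m\in\mathrm{MIrr}(L)$ put $\beta(m):=\max\{i\mid m\ge x_{i-1}\}$. For a cover relation $b\lessdot c$ define - $\gamma_1(b\lessdot c):=\min\{\delta(j)\mid j\in\mathrm{JIrr}(L),\ j\le c,\ j\not\le b\}$, - $\gamma_2(b\lessdot c):=\min\{i\mid b\vee x_i\ge c\}$, - $\gamma_3(b\lessdot c):=\max\{\beta(m)\mid m\in\mathrm{MIrr}(L),\ m\ge b,\ m\not\ge c\}$, - $\gamma_4(b\lessdot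 c):=\max\{i\mid c\wedge x_{i-1}\le b\}$. The index $i$ ranges over $\{0,\dots,k\}$ in the definitions of $\delta$ and $\gamma_2$, and over $\{1,\dots,k\}$ in the definitions of $\beta$ and $\gamma_4$. *)

(* Defs.v *)
From mathcomp Require Import all_boot all_order.
Set Implicit Arguments.
Unset Strict Implicit.
Unset Printing Implicit Defensive.
Import Order.Theory.
Local Open Scope order_scope.

Section FiniteLattice.
Context {d : Order.disp_t} {L : finTBLatticeType d}.

(* [covers b c] : c covers b. *)
Definition covers (b c : L) : bool :=
  (b < c) && [forall z : L, ~~ (b < z < c)].

Definition JIrr : {set L} := [set j | #|[set z | covers z j]| == 1%N].

Definition MIrr : {set L} := [set m | #|[set z | covers m z]| == 1%N].

Definition left_modular (a : L) : Prop :=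
  forall b c : L, b < c -> (b `|` a) `&` c = b `|` (a `&` c).

(* A chain x_0 < ... < x_k is a family indexed by 'I_k.+1.  Every candidate
   index is at most k, so \big[minn/k] is the minimum of any nonempty set of
   indices.  The default values (k for minima, 0 for maxima) matter only for
   empty index sets, which do not occur for j in JIrr, m in MIrr and covers b c
   when x_0 = \bot and x_k = \top. *)
Variables (k : nat) (x : 'I_k.+1 -> L).

Definition delta (j : L) : nat :=
  \big[minn/k]_(i < k.+1 | j <= x i) i.

(* In beta and gamma4, i ranges over 1, ..., k and [inord i.-1] is the index
   i - 1, which is in range. *)
Definition beta (m : L) : nat :=
  \big[maxn/0%N]_(i < k.+1 | (0 < i)%N && (x (inord i.-1) <= m)) i.

Definition gamma1 (b c : L) : nat :=
  \big[minn/k]_(j in JIrr | (j <= c) && ~~ (j <= b)) delta j.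

Definition gamma2 (b c : L) : nat :=
  \big[minn/k]_(i < k.+1 | c <= b `|` x i) i.

Definition gamma3 (b c : L) : nat :=
  \big[maxn/0%N]_(m in MIrr | (b <= m) && ~~ (c <= m)) beta m.

Definition gamma4 (b c : L) : nat :=
  \big[maxn/0%N]_(i < k.+1 | (0 < i)%N && (c `&` x (inord i.-1) <= b)) i.

End FiniteLattice.

(* Main.v *)
Require Import Defs.
From mathcomp Require Import all_boot all_order.
Set Implicit Arguments.
Unset Strict Implicit.
Unset Printing Implicit Defensive.
Import Order.Theory.
Local Open Scope order_scope.

(** Each of the four labels is determined by the set of indices [i] that it does
    not exceed: both [gamma2 <= i] and [gamma3 <= i] say that [c <= b \/ x_i],
    while [gamma1 <= i] and [gamma4 <= i] say that [c /\ x_i] is not below [b].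
    For a cover the second condition implies the first, since
    [b \/ (c /\ x_i)] lies in [(b, c]].  The two conditions agree on all covers
    exactly when every [x_i] is left modular: if [b \/ (a /\ c)] is strictly
    below [(b \/ a) /\ c], any cover between these two elements satisfies the
    first condition but not the second. *)

(** The default [k] competes in the minimum, which accounts for the first disjunct. *)
Lemma bigmin_leqP (I : finType) (P : pred I) (F : I -> nat) (k n : nat) :
  reflect ((k <= n)%N \/ exists2 i, P i & (F i <= n)%N)
          (\big[minn/k]_(i | P i) F i <= n)%N.
Proof.
have -> : (\big[minn/k]_(i | P i) F i <= n)%N
        = (k <= n)%N || has (fun i => P i && (F i <= n)%N) (index_enum I).
  elim: (index_enum I) => [|i s IHs]; first by rewrite big_nil orbF.
  rewrite big_cons /=; case: (P i) => //=.
  by rewrite geq_min IHs orbCA.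
apply: (iffP orP) => -[kn|H]; try by left.
  by case/hasP: H => i _ /andP[Pi Fi]; right; exists i.
by case: H => i Pi Fi; right; apply/hasP; exists i; rewrite ?mem_index_enum ?Pi.
Qed.

Lemma ltn_bigmaxP (I : finType) (P : pred I) (F : I -> nat) (n : nat) :
  reflect (exists2 i, P i & (n < F i)%N) (n < \max_(i | P i) F i)%N.
Proof.
rewrite ltnNge; apply: (iffP idP) => [|[i Pi nFi]]; last first.
  by apply/negP => /bigmax_leqP/(_ i Pi); rewrite leqNgt nFi.
case: (pickP (fun i => P i && (n < F i)%N)) => [i /andP[Pi nFi] _|noi].
  by exists i.
case/negP; apply/bigmax_leqP => i Pi; rewrite leqNgt.
by have /= := noi i; rewrite Pi /= => ->.
Qed.

(** The minimum of an up-closed set of indices determines the set; [P ord_max] makes the default [k]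
    a genuine candidate. *)
Lemma leq_bigmin_ord (k : nat) (P : pred 'I_k.+1) (n : 'I_k.+1) :
  (forall i j : 'I_k.+1, (i <= j)%N -> P i -> P j) -> P ord_max ->
  (\big[minn/k]_(i < k.+1 | P i) i <= n)%N = P n.
Proof.
move=> P_up P_max; apply/bigmin_leqP/idP => [[kn|[i Pi le_in]]|Pn].
- exact: P_up P_max.
- exact: P_up Pi.
- by right; exists n.
Qed.

(** The candidates are the successors of members of a down-closed set, hence the strict inequality.
    Since [ord_max] is not a member, every member has a successor in range. *)
Lemma ltn_bigmax_ord (k : nat) (P : pred 'I_k.+1) (n : 'I_k.+1) :
  (forall i j : 'I_k.+1, (i <= j)%N -> P j -> P i) -> ~~ P ord_max ->
  (n < \max_(i < k.+1 | (0 < i)%N && P (inord i.-1)) i)%N = P n.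
Proof.
move=> P_down PN_max; apply/ltn_bigmaxP/idP => [[i /andP[i_gt0 Pi] lt_ni]|Pn].
  apply: P_down Pi; rewrite inordK; last exact: leq_ltn_trans (leq_pred _) _.
  by rewrite -ltnS prednK.
have lt_nk : (n < k)%N.
  rewrite ltn_neqAle -ltnS ltn_ord andbT; apply: contraNneq PN_max => nk.
  by rewrite -(_ : n = ord_max) //; apply: val_inj.
by exists (inord n.+1); rewrite inordK //= inord_val.
Qed.

(** Labels are compared through indices [i <= k] only; the bound on [h] makes [h] itself such an
    index. *)
Lemma leq_threshold (k g h : nat) :
  (h <= k)%N -> (forall i : 'I_k.+1, (h <= i)%N -> (g <= i)%N) -> (g <= h)%N.
Proof. by move=> hk; move/(_ (Ordinal (hk : (h < k.+1)%N)))/(_ (leqnn h)). Qed.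

Section Covers.
Context {d : Order.disp_t} {L : finTBLatticeType d}.
Implicit Types a b c u v z : L.

Lemma covers_lt b c : covers b c -> b < c.
Proof. by case/andP. Qed.

Lemma covers_eq b c z : covers b c -> b < z -> z <= c -> z = c.
Proof.
case/andP=> _ /forallP/(_ z); rewrite negb_and => /orP[/negbTE->//|zc] _.
by rewrite le_eqVlt (negbTE zc) orbF => /eqP.
Qed.

Lemma exists_minimal (P : pred L) a :
  P a -> exists2 z, P z & forall y, y < z -> ~~ P y.
Proof.
(* Induction on the number of elements strictly below [a]. *)
have [n] := ubnP #|[set y | y < a]|; elim: n a => // n IHn a le_an Pa.
case: (pickP (fun y => (y < a) && P y)) => [y /andP[lt_ya Py]|noy].
  apply: IHn Py; apply: leq_trans (proper_card _) le_an.
  apply/properP; split; last by exists y; rewrite !inE ?lt_ya ?ltxx.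
  by apply/subsetP => w; rewrite !inE => /lt_trans; apply.
by exists a => // y lt_ya; have /= := noy y; rewrite lt_ya /= => ->.
Qed.

Lemma exists_covers_above u v : u < v -> exists2 c, covers u c & c <= v.
Proof.
move=> uv; have [|c /andP[uc cv] cmin] := @exists_minimal (fun c => u < c <= v) v.
  by rewrite uv lexx.
exists c => //; rewrite /covers uc; apply/forallP => z; apply/negP => /andP[uz zc].
by have := cmin z zc; rewrite uz (le_trans (ltW zc) cv).
Qed.

End Covers.

Lemma covers_dual (d : Order.disp_t) (L : finTBLatticeType d) (b c : L) :
  @covers _ L^d b c = covers c b.
Proof.
by congr andb; apply: eq_forallb => z; rewrite !ltEdual andbC.
Qed.

Lemma exists_covers_below (d : Order.disp_t) (L : finTBLatticeType d) (u v : L) :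
  u < v -> exists2 b, covers b v & u <= b.
Proof.
move=> uv; have [b] := @exists_covers_above _ L^d v u uv.
by rewrite covers_dual leEdual; exists b.
Qed.

(** Take [j] minimal among the elements below [a] but not below [b]. Everything strictly below [j]
    is then below [b], so [j] cannot be a join of smaller elements. *)
Lemma exists_JIrr (d : Order.disp_t) (L : finTBLatticeType d) (a b : L) :
  ~~ (a <= b) -> exists2 j, j \in JIrr & (j <= a) && ~~ (j <= b).
Proof.
move=> ab; have [|j /andP[ja jb] jmin] :=
  @exists_minimal _ L (fun j => (j <= a) && ~~ (j <= b)) a; first by rewrite lexx.
have below_b z : z < j -> z <= b.
  move=> zj; have := jmin z zj.
  by rewrite (le_trans (ltW zj) ja) /= negbK.
exists j; last by rewrite ja jb.
have [|z zj _] := @exists_covers_below _ L \bot j.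
  by rewrite lt0x; apply: contraNneq jb => ->; rewrite le0x.
rewrite inE; apply/cards1P; exists z; apply/setP => y; rewrite !inE.
apply/idP/eqP => [yj|->//]; apply: contraNeq jb => yz.
(* Two distinct elements covered by [j] would join to [j]. *)
have [yz_le|yNz] := boolP (z <= y).
  have zy : z < y by rewrite lt_neqAle eq_sym yz.
  by have := covers_lt yj; rewrite (covers_eq zj zy (ltW (covers_lt yj))) ltxx.
have <- : y `|` z = j.
  apply: (covers_eq yj); first by rewrite lt_leAnge leUl leUx lexx.
  by rewrite leUx !ltW ?covers_lt.
by rewrite leUx !below_b ?covers_lt.
Qed.

(** This is [exists_JIrr] in the dual lattice, where [a] and [b] trade places. *)
Lemma exists_MIrr (d : Order.disp_t) (L : finTBLatticeType d) (a b : L) :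
  ~~ (a <= b) -> exists2 m, m \in MIrr & (b <= m) && ~~ (a <= m).
Proof.
move=> ab; have [m mJ mP] := @exists_JIrr _ L^d b a ab.
exists m => //; move: mJ; rewrite !inE.
by under eq_finset do rewrite covers_dual.
Qed.

Section Labels.
Context {d : Order.disp_t} {L : finTBLatticeType d}.
Variables (k : nat) (x : 'I_k.+1 -> L).
Hypothesis x_top : x ord_max = \top.
Hypothesis x_le : forall i j : 'I_k.+1, (i <= j)%N -> x i <= x j.
Implicit Types (b c : L) (i : 'I_k.+1).

Lemma leq_delta (j : L) i : (delta x j <= i)%N = (j <= x i).
Proof.
rewrite /delta leq_bigmin_ord // ?x_top ?lex1 // => i1 i2 le_i jx.
exact: le_trans jx (x_le le_i).
Qed.

(** At [m = \top] the equivalence would fail for [i = ord_max], because [beta] never exceeds [k]. *)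
Lemma ltn_beta (m : L) i : m != \top -> (i < beta x m)%N = (x i <= m).
Proof.
move=> m_top; rewrite /beta (@ltn_bigmax_ord _ (fun i => x i <= m)) //.
  by move=> i1 i2 /x_le; apply: le_trans.
by rewrite x_top le1x.
Qed.

Lemma leq_gamma1 b c i :
  ~~ (c <= b) -> (gamma1 x b c <= i)%N = ~~ (c `&` x i <= b).
Proof.
move=> cb; apply/bigmin_leqP/idP => [H|].
  have [j [jc jb jx]] : exists j, [/\ j <= c, ~~ (j <= b) & j <= x i].
    case: H => [ki|[j /and3P[_ jc jb]]]; last by rewrite leq_delta => jx; exists j.
    (* If the bound comes from the default [k], then [x i] is [\top] and [c] itself is a witness;
       irreducibility is not asked for here. *)
    by exists c; split=> //; apply: le_trans (x_le (ki : (@ord_max k <= i)%N));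
      rewrite x_top lex1.
  by apply: contraNN jb => /(le_trans _); apply; rewrite lexI jc.
case/exists_JIrr => j jJ /andP[]; rewrite lexI => /andP[jc jx] jb.
by right; exists j; rewrite ?leq_delta // jJ jc.
Qed.

Lemma leq_gamma2 b c i : (gamma2 x b c <= i)%N = (c <= b `|` x i).
Proof.
rewrite /gamma2 (@leq_bigmin_ord _ (fun i => c <= b `|` x i)) //.
  by move=> i1 i2 /x_le le_x /le_trans; apply; apply: leU2.
by rewrite x_top joinx1 lex1.
Qed.

Lemma leq_gamma3 b c i : (gamma3 x b c <= i)%N = (c <= b `|` x i).
Proof.
rewrite leqNgt; apply: negb_inj; rewrite negbK.
(* An element not above [c] differs from [\top]. *)
have ltn_beta' m : ~~ (c <= m) -> (i < beta x m)%N = (x i <= m).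
  by move=> cm; rewrite ltn_beta //; apply: contraNneq cm => ->; rewrite lex1.
apply/ltn_bigmaxP/idP => [[m /and3P[_ bm cm]]|].
  rewrite ltn_beta' // => xm; apply: contraNN cm => /le_trans; apply.
  by rewrite leUx bm.
case/exists_MIrr => m mM /andP[]; rewrite leUx => /andP[bm xm] cm.
by exists m; rewrite ?ltn_beta' // mM bm.
Qed.

Lemma leq_gamma4 b c i :
  ~~ (c <= b) -> (gamma4 x b c <= i)%N = ~~ (c `&` x i <= b).
Proof.
move=> cb; rewrite leqNgt /gamma4.
rewrite (@ltn_bigmax_ord _ (fun i => c `&` x i <= b)) //.
  by move=> i1 i2 /x_le le_x; apply: le_trans; apply: leI2.
by rewrite x_top meetx1.
Qed.

End Labels.

Theorem theorem3p2 (d : Order.disp_t) (L : finTBLatticeType d)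
    (k : nat) (x : 'I_k.+1 -> L)
    (x_bot : x ord0 = \bot) (x_top : x ord_max = \top)
    (x_lt : forall i j : 'I_k.+1, (i < j)%N -> x i < x j) :
  (forall b c : L, covers b c ->
     [/\ gamma2 x b c = gamma3 x b c,
         (gamma3 x b c <= gamma1 x b c)%N
       & gamma1 x b c = gamma4 x b c]) /\
  ((forall b c : L, covers b c -> gamma2 x b c = gamma4 x b c) <->
   (forall i : 'I_k.+1, left_modular (x i))).
Proof.
have x_le (i j : 'I_k.+1) : (i <= j)%N -> x i <= x j.
  by rewrite leq_eqVlt => /predU1P[/val_inj->//|/x_lt/ltW].
have coversN (b c : L) : covers b c -> ~~ (c <= b).
  by move/covers_lt; rewrite lt_leAnge => /andP[].
have le1 b c i (bc : covers b c) := leq_gamma1 x_top x_le i (coversN b c bc).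
have le4 b c i (bc : covers b c) := leq_gamma4 x_top x_le i (coversN b c bc).
have le2 := leq_gamma2 x_top x_le.
have le3 := leq_gamma3 x_top x_le.
have bound2 b c : (gamma2 x b c <= k)%N.
  by rewrite (le2 _ _ ord_max) x_top joinx1 lex1.
have bound3 b c : (gamma3 x b c <= k)%N.
  by rewrite (le3 _ _ ord_max) x_top joinx1 lex1.
have bound1 b c : covers b c -> (gamma1 x b c <= k)%N.
  by move=> bc; rewrite (le1 _ _ ord_max bc) x_top meetx1 coversN.
have bound4 b c : covers b c -> (gamma4 x b c <= k)%N.
  by move=> bc; rewrite (le4 _ _ ord_max bc) x_top meetx1 coversN.
have le31 b c : covers b c -> (gamma3 x b c <= gamma1 x b c)%N.
  move=> bc; apply: leq_threshold (bound1 b c bc) _ => i.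
  rewrite le1 // le3 => cxb.
  rewrite -(covers_eq (z := b `|` (c `&` x i)) bc).
  - by rewrite leU2 // leIr.
  - by rewrite lt_leAnge leUl leUx lexx.
  - by rewrite leUx leIl ltW // covers_lt.
have eq23 b c : gamma2 x b c = gamma3 x b c.
  apply/eqP; rewrite eqn_leq; apply/andP; split;
    by apply: (@leq_threshold k) => // i; rewrite le2 le3.
have eq14 b c : covers b c -> gamma1 x b c = gamma4 x b c.
  move=> bc; apply/eqP; rewrite eqn_leq; apply/andP; split;
    apply: (@leq_threshold k) => [|i]; rewrite ?bound1 ?bound4 //;
    by rewrite le1 ?le4.
split=> [b c bc|]; first by split; [exact: eq23|exact: le31|exact: eq14].
split=> [eq24 i b c bc|lm b c bc].
  set u := b `|` (x i `&` c); set v := (b `|` x i) `&` c.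
  have le_uv : u <= v by rewrite leUx !lexI leUl ltW //= leIr leIxl // leUr.
  apply/eqP; rewrite eq_sym; apply: contraT => neq_uv.
  have [|q uq qv] := @exists_covers_above _ _ u v; first by rewrite lt_neqAle neq_uv.
  (* The chain [q <= v <= b \/ x i <= u \/ x i] gives the first condition for the cover of [u] by
     [q]. *)
  have : (gamma2 x u q <= i)%N.
    rewrite le2; apply: le_trans qv _; apply: leIxl.
    by rewrite leU2 // leUl.
  rewrite eq24 // le4 //; case/negP.
  (* The second condition fails: [q <= v <= c] puts the meet of [q] and [x i] below that of [x i]
     and [c], hence below [u]. *)
  rewrite /u; apply: lexUr; rewrite lexI leIr /=.
  by apply: leIxl; apply: le_trans qv (leIr _ _).
(* One inequality is [le31] up to the two equalities; only [gamma4 <= gamma2] remains. *)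
apply/eqP; rewrite eqn_leq eq23 -eq14 // le31 //= eq14 // -eq23.
apply: leq_threshold (bound2 b c) _ => i.
rewrite le2 le4 // => cbx.
apply: contraNN (coversN _ _ bc) => cxb.
(* As [c <= b \/ x i], left modularity writes [c] as the join of [b] and the meet of [x i] with [c];
   were that meet below [b], so would be [c]. *)
have := lm i b c (covers_lt bc); rewrite (meet_r cbx) => ->.
by rewrite leUx lexx meetC.
Qed.
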